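(* Let $n \ge 2$ and let $VSG_n$ be the virtual singular braid group on $n$ strands. (1) The group $VSG_n$ is not residually nilpotent for $n \ge 3$. (2) The commutator subgroup $[VSG_n, VSG_n]$ is perfect for $n \ge 5$.
   Context: For $n\ge 2$, $VSG_n$ is the group with generators $\sigma_1,\dots,\sigma_{n-1},\tau_1,\dots,\tau_{n-1},v_1,\dots,v_{n-1}$ and relations (for all admissible indices): $\sigma_i\sigma_j=\sigma_j\sigma_i$, $v_iv_j=v_jv_i$, $\tau_i\tau_j=\tau_j\tau_i$, $\sigma_i\tau_j=\tau_j\sigma_i$, $\sigma_iv_j=v_j\sigma_i$, $\tau_iv_j=v_j\tau_i$ whenever $|i-j|\ge 2$; $v_i^2=1$ and $\sigma_i\tau_i=\tau_i\sigma_i$ for $1\le i\le n-1$; and for $1\le i\le n-2$: $\sigma_i\sigma_{i+1}\sigma_i=\sigma_{i+1}\sigma_i\sigma_{i+1}$, $v_iv_{i+1}v_i=v_{i+1}v_iv_{i+1}$, $\sigma_i\sigma_{i+1}\tau_i=\tau_{i+1}\sigma_i\sigma_{i+1}$, $\sigma_{i+1}\sigma_i\tau_{i+1}=\tau_i\sigma_{i+1}\sigma_i$, $v_i\sigma_{i+1}v_i=v_{i+1}\sigma_iv_{i+1}$, $v_i\tau_{i+1}v_i=v_{i+1}\tau_iv_{i+1}$. A group $G$ is residually nilpotent if for every non-trivial $g\in G$ there is a surjective homomorphism $\phi$ from $G$ onto a nilpotent group with $\phi(g)\ne 1$; equivalently $\bigcap_{i\ge1}\Gamma_i(G)=\{1\}$,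 where $\Gamma_1(G)=G$ and $\Gamma_i(G)=[\Gamma_{i-1}(G),G]$. A group $G$ is perfect if $G=[G,G]$. *)

(* Defs.v *)
From HB Require Import structures.
From mathcomp Require Import all_boot.
From mathcomp Require Import boolp classical_sets.

Set Implicit Arguments.
Unset Strict Implicit.
Unset Printing Implicit Defensive.

Local Open Scope classical_set_scope.
Local Open Scope quotient_scope.
Local Open Scope group_scope.

(* The letter [(x, false)] stands for the generator [x], and [(x, true)] for
   its inverse. *)
Definition word (X : Type) := seq (X * bool).

Definition letter (X : Type) (x : X) : X * bool := (x, false).

Definition flip (X : Type) (l : X * bool) : X * bool := (l.1, ~~ l.2).

Definition winv (X : Type) (w : word X) : word X := rev (map (@flip X) w).

(* [R r s] is the relation "r = s" of the presentation. *)
Inductive pres_eq (X : Type) (R : word X -> word X -> Prop) :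
  word X -> word X -> Prop :=
| pres_refl u : pres_eq R u u
| pres_sym u v : pres_eq R u v -> pres_eq R v u
| pres_trans v u w : pres_eq R u v -> pres_eq R v w -> pres_eq R u w
| pres_cancel u l v : pres_eq R (u ++ l :: flip l :: v) (u ++ v)
| pres_rel u r s v : R r s -> pres_eq R (u ++ r ++ v) (u ++ s ++ v).

Definition pres_eqb (X : choiceType) (R : word X -> word X -> Prop) :
  rel (word X) := fun u v => `[< pres_eq R u v >].

Lemma pres_eqb_equiv (X : choiceType) (R : word X -> word X -> Prop) :
  equiv_class_of (pres_eqb R).
Proof.
split=> [u|u v|v u w].
- exact/asboolP/pres_refl.
- by apply/asboolP/asboolP; apply: pres_sym.
- by move=> /asboolP uv /asboolP vw; apply/asboolP; apply: pres_trans vw.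
Qed.

Canonical pres_equiv (X : choiceType) (R : word X -> word X -> Prop) :=
  EquivRelPack (pres_eqb_equiv R).

Definition presented (X : choiceType) (R : word X -> word X -> Prop) : Type :=
  {eq_quot pres_equiv R}.

HB.instance Definition _ (X : choiceType) (R : word X -> word X -> Prop) :=
  Choice.copy (presented R) {eq_quot pres_equiv R}.

Definition pres_class (X : choiceType) (R : word X -> word X -> Prop)
  (w : word X) : presented R := \pi_{eq_quot pres_equiv R} w.
Arguments pres_class {X} R w.

Definition pres_repr (X : choiceType) (R : word X -> word X -> Prop)
  (x : presented R) : word X := repr (x : {eq_quot pres_equiv R}).

Definition pres_mul (X : choiceType) (R : word X -> word X -> Prop)
    (x y : presented R) : presented R :=
  pres_class R (pres_repr x ++ pres_repr y).

Definition pres_one (X : choiceType) (R : word X -> word X -> Prop) :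
  presented R := pres_class R [::].

Definition pres_inv (X : choiceType) (R : word X -> word X -> Prop)
  (x : presented R) : presented R := pres_class R (winv (pres_repr x)).

Lemma pres_classP (X : choiceType) (R : word X -> word X -> Prop) u v :
  pres_class R u = pres_class R v <-> pres_eq R u v.
Proof.
split=> [/eqP|uv]; first by rewrite eqmodE => /asboolP.
by apply/eqP; rewrite eqmodE; apply/asboolP.
Qed.

Lemma pres_reprK (X : choiceType) (R : word X -> word X -> Prop) :
  cancel (@pres_repr X R) (pres_class R).
Proof. exact: reprK. Qed.

Lemma pres_eq_ctx (X : Type) (R : word X -> word X -> Prop) a b u v :
  pres_eq R u v -> pres_eq R (a ++ u ++ b) (a ++ v ++ b).
Proof.
elim=> {u v} [u|u v _|v u w _ + _|u l v|u r s v rs].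
- exact: pres_refl.
- exact: pres_sym.
- exact: pres_trans.
- rewrite -!catA !cat_cons !(catA a); exact: pres_cancel.
- rewrite -!catA !(catA a u); exact: pres_rel.
Qed.

Lemma pres_classM (X : choiceType) (R : word X -> word X -> Prop) u v :
  pres_mul (pres_class R u) (pres_class R v) = pres_class R (u ++ v).
Proof.
have piK w : pres_eq R (pres_repr (pres_class R w)) w.
  by apply/pres_classP; rewrite pres_reprK.
apply/pres_classP; apply: (pres_trans (v := u ++ pres_repr (pres_class R v))).
  exact: (pres_eq_ctx [::]).
rewrite -[X in pres_eq _ (_ ++ X)]cats0 -[X in pres_eq _ _ (_ ++ X)]cats0.
exact: pres_eq_ctx.
Qed.

Lemma pres_mulA (X : choiceType) (R : word X -> word X -> Prop) :
  associative (@pres_mul X R).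
Proof.
move=> x y z; rewrite -(pres_reprK x) -(pres_reprK y) -(pres_reprK z).
move: (pres_repr x) (pres_repr y) (pres_repr z) => u v w.
by rewrite (pres_classM _ v) (pres_classM _ u v) !pres_classM catA.
Qed.

Lemma pres_mul1 (X : choiceType) (R : word X -> word X -> Prop) :
  left_id (@pres_one X R) (@pres_mul X R).
Proof.
move=> x; rewrite -(pres_reprK x); move: (pres_repr x) => u.
exact: (pres_classM _ [::]).
Qed.

Lemma pres_mulx1 (X : choiceType) (R : word X -> word X -> Prop) :
  right_id (@pres_one X R) (@pres_mul X R).
Proof.
move=> x; rewrite -(pres_reprK x); move: (pres_repr x) => u.
by rewrite (pres_classM _ u [::]) cats0.
Qed.

Lemma winvK (X : Type) : involutive (@winv X).
Proof.
move=> w; rewrite /winv map_rev revK; apply: mapK => -[x b].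
by rewrite /flip /= negbK.
Qed.

Lemma pres_eq_winv (X : Type) (R : word X -> word X -> Prop) u :
  pres_eq R (u ++ winv u) [::].
Proof.
elim: u => [|l u IHu]; first exact: pres_refl.
rewrite /winv /= rev_cons -cats1.
have := pres_eq_ctx [:: l] [:: flip l] IHu; rewrite -catA /= => IH.
apply: pres_trans IH _; exact: (pres_cancel R [::] l [::]).
Qed.

Lemma pres_mulxV (X : choiceType) (R : word X -> word X -> Prop) :
  right_inverse (@pres_one X R) (@pres_inv X R) (@pres_mul X R).
Proof.
move=> x; rewrite -[X in pres_mul X]pres_reprK pres_classM.
by apply/pres_classP; exact: pres_eq_winv.
Qed.

Lemma pres_mulVx (X : choiceType) (R : word X -> word X -> Prop) :
  left_inverse (@pres_one X R) (@pres_inv X R) (@pres_mul X R).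
Proof.
move=> x; rewrite -[X in pres_mul _ X]pres_reprK pres_classM.
apply/pres_classP; rewrite -[X in _ ++ X]winvK; exact: pres_eq_winv.
Qed.

HB.instance Definition _ (X : choiceType) (R : word X -> word X -> Prop) :=
  isGroup.Build (presented R) (@pres_mulA X R) (@pres_mul1 X R)
    (@pres_mulx1 X R) (@pres_mulVx X R) (@pres_mulxV X R).

Definition subgroup (G : groupType) (H : set G) : Prop := group_closed [in H].

Definition commutator (G : groupType) (A B : set G) : set G :=
  smallest (@subgroup G) [set [~ a, b] | a in A & b in B].

(* Indexed from 0: [lower_central G i] is the usual Gamma_{i+1}(G). *)
Fixpoint lower_central (G : groupType) (i : nat) : set G :=
  if i is i'.+1 then commutator (@lower_central G i') setT else setT.

Arguments lower_central : clear implicits.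

Definition nilpotent_group (G : groupType) : Prop :=
  exists c : nat, lower_central G c = [set 1].

Definition residually_nilpotent (G : groupType) : Prop :=
  forall g : G, g <> 1 ->
    exists (N : groupType) (phi : {multiplicative G -> N}),
      [/\ nilpotent_group N, forall y : N, exists x : G, phi x = y
        & phi g <> 1].

(* For a subgroup H of G, the commutators of elements of H are the same in H
   and in G, so this says that the group H is perfect. *)
Definition perfect_subgroup (G : groupType) (H : set G) : Prop :=
  H = commutator H H.

(* The indices 1, ..., n-1 are represented by 0, ..., n-2. *)
Inductive vsg_gen (n : nat) :=
| Sigma of 'I_n.-1
| Tau of 'I_n.-1
| Virt of 'I_n.-1.

Definition vsg_gen_code n (x : vsg_gen n) : 'I_n.-1 + 'I_n.-1 + 'I_n.-1 :=
  match x with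
  | Sigma i => inl (inl i)
  | Tau i => inl (inr i)
  | Virt i => inr i
  end.

Definition vsg_gen_decode n (c : 'I_n.-1 + 'I_n.-1 + 'I_n.-1) : vsg_gen n :=
  match c with
  | inl (inl i) => Sigma i
  | inl (inr i) => Tau i
  | inr i => Virt i
  end.

Lemma vsg_gen_codeK n : cancel (@vsg_gen_code n) (@vsg_gen_decode n).
Proof. by case. Qed.

HB.instance Definition _ n := Countable.copy (vsg_gen n)
  (can_type (@vsg_gen_codeK n)).

Definition far (m : nat) (i j : 'I_m) : bool := (i.+1 < j) || (j.+1 < i).

Local Notation s i := (letter (Sigma i)).
Local Notation t i := (letter (Tau i)).
Local Notation v i := (letter (Virt i)).

Inductive vsg_rel (n : nat) : word (vsg_gen n) -> word (vsg_gen n) -> Prop :=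
| vsg_far_ss (i j : 'I_n.-1) : far i j ->
    vsg_rel [:: s i; s j] [:: s j; s i]
| vsg_far_vv (i j : 'I_n.-1) : far i j ->
    vsg_rel [:: v i; v j] [:: v j; v i]
| vsg_far_tt (i j : 'I_n.-1) : far i j ->
    vsg_rel [:: t i; t j] [:: t j; t i]
| vsg_far_st (i j : 'I_n.-1) : far i j ->
    vsg_rel [:: s i; t j] [:: t j; s i]
| vsg_far_sv (i j : 'I_n.-1) : far i j ->
    vsg_rel [:: s i; v j] [:: v j; s i]
| vsg_far_tv (i j : 'I_n.-1) : far i j ->
    vsg_rel [:: t i; v j] [:: v j; t i]
| vsg_vv (i : 'I_n.-1) : vsg_rel [:: v i; v i] [::]
| vsg_st (i : 'I_n.-1) : vsg_rel [:: s i; t i] [:: t i; s i]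
| vsg_sss (i j : 'I_n.-1) : j = i.+1 :> nat ->
    vsg_rel [:: s i; s j; s i] [:: s j; s i; s j]
| vsg_vvv (i j : 'I_n.-1) : j = i.+1 :> nat ->
    vsg_rel [:: v i; v j; v i] [:: v j; v i; v j]
| vsg_sst (i j : 'I_n.-1) : j = i.+1 :> nat ->
    vsg_rel [:: s i; s j; t i] [:: t j; s i; s j]
| vsg_sst' (i j : 'I_n.-1) : j = i.+1 :> nat ->
    vsg_rel [:: s j; s i; t j] [:: t i; s j; s i]
| vsg_vsv (i j : 'I_n.-1) : j = i.+1 :> nat ->
    vsg_rel [:: v i; s j; v i] [:: v j; s i; v j]
| vsg_vtv (i j : 'I_n.-1) : j = i.+1 :> nat ->
    vsg_rel [:: v i; t j; v i] [:: v j; t i; v j].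

Definition VSG (n : nat) : groupType := presented (@vsg_rel n).

(* Main.v *)
From HB Require Import structures.
From mathcomp Require Import all_boot fingroup perm.
Require Import Defs.
From mathcomp Require Import all_boot.
From mathcomp Require Import boolp classical_sets.
From mathcomp Require Import zify.

(** Sending the [v_i] to adjacent transpositions and the other generators to 1
    defines a morphism to the symmetric group, so [x = v_1 v_2] is not trivial;
    but [x = [x, v_1]] because [x^3 = 1] and [v_1] inverts [x], so [x] lies in
    every term of the lower central series.

    Write s, t, v for the sigma, tau and v generators.  For n >= 5, let Q be
    the quotient of [VSG_n] by the derived subgroup of
    [VSG_n'].  In Q the elements [s_1 s_4^-1] and [s_2 s_4^-1] commute, since
    they come from [VSG_n']; as [s_4] commutes with [s_1] and [s_2], these two
    commute, and the braid relation gives [s_1 = s_2].  Commutation at distance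
    2 propagates this to [s_1 = s_2 = s_3 = ...].  The same holds for the [v_i],
    then the mixed relations identify the [t_i], and the relations at distance
    2 show that Q is abelian. *)

Set Implicit Arguments.
Unset Strict Implicit.
Unset Printing Implicit Defensive.

Local Open Scope classical_set_scope.
Local Open Scope group_scope.

(** * Subgroups, normal sets and commutators *)

Lemma multiplicative1 (G H : groupType) (phi : {multiplicative G -> H}) :
  phi 1 = 1.
Proof. by apply: (mulgI (phi 1)); rewrite -gmulfM !mulg1. Qed.

Lemma subgroupP (G : groupType) (A : set G) :
  subgroup A <-> A 1 /\ forall x y, A x -> A y -> A (x / y).
Proof.
split=> [[A1 AF]|[A1 AF]].
  split=> [|x y /mem_set xA /mem_set yA]; apply: set_mem; first exact: A1.
  exact: AF.
split=> [|x y /set_mem xA /set_mem yA]; apply: mem_set => //; exact: AF.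
Qed.

Section Subgroups.
Variables (G : groupType) (A : set G).
Hypothesis sA : subgroup A.

Lemma subgroup1 : A 1.
Proof. by case/subgroupP: sA. Qed.

Lemma subgroupF x y : A x -> A y -> A (x / y).
Proof. by case/subgroupP: sA => _; apply. Qed.

Lemma subgroupV x : A x -> A x^-1.
Proof.
by move=> Ax; rewrite -div1g; apply: subgroupF => //; apply: subgroup1.
Qed.

Lemma subgroupM x y : A x -> A y -> A (x * y).
Proof. by move=> Ax Ay; rewrite -[y]invgK; apply/subgroupF/subgroupV. Qed.

End Subgroups.

Definition normal_set (G : groupType) (A : set G) : Prop :=
  forall x y, A x -> A (x ^ y).

Lemma subgroup_set1 (G : groupType) : subgroup [set (1 : G)].
Proof. by apply/subgroupP; split=> // x y /= -> ->; rewrite divgg. Qed.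

Lemma normal_set1 (G : groupType) : normal_set [set (1 : G)].
Proof. by move=> x y /= ->; apply: conj1g. Qed.

Lemma commutator_subgroup (G : groupType) (A B : set G) :
  subgroup (commutator A B).
Proof.
apply/subgroupP; split=> [M [sM _]|x y cx cy M [sM ABM]].
  exact: subgroup1.
by apply: subgroupF => //; [apply: cx|apply: cy].
Qed.

Lemma mem_commutator (G : groupType) (A B : set G) a b :
  A a -> B b -> commutator A B [~ a, b].
Proof. by move=> Aa Bb; apply: sub_gen_smallest; exists a => //; exists b. Qed.

Lemma commutator_sub (G : groupType) (A B C : set G) : subgroup C ->
  (forall a b, A a -> B b -> C [~ a, b]) -> commutator A B `<=` C.
Proof.
move=> sC ABC; apply: smallest_sub => // _ [a Aa [b Bb <-]]; exact: ABC.
Qed.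

Lemma commutator_normal (G : groupType) (A B : set G) :
  normal_set A -> normal_set B -> normal_set (commutator A B).
Proof.
move=> nA nB x y; move: x.
(* The elements whose conjugate by [y] stays in the commutator form a subgroup, so it suffices to
   treat the generating commutators. *)
apply: (@commutator_sub _ A B [set x | commutator A B (x ^ y)]).
  have sC := commutator_subgroup A B.
  apply/subgroupP; split=> [|x z /= Cx Cz]; rewrite /= ?conj1g ?conjMg ?conjVg.
    exact: subgroup1 sC.
  exact: subgroupF sC _ _ Cx Cz.
move=> a b Aa Bb /=; rewrite conjRg.
by apply: mem_commutator; [apply: nA|apply: nB].
Qed.

(** * Presented groups, evaluation of words and quotients *)

Section Presentations.
Variables (X : choiceType) (R : word X -> word X -> Prop).

Lemma pres_class_cons l l' w :
  pres_class R [:: l, l' & w] =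
  pres_class R [:: l] * pres_class R (l' :: w) :> presented R.
Proof. by rewrite [RHS]pres_classM. Qed.

Lemma pres_class_rel r s : R r s -> pres_class R r = pres_class R s.
Proof.
move=> rs; apply/pres_classP.
by have := pres_rel [::] [::] rs; rewrite !cats0.
Qed.

Lemma pres_class_inv x :
  pres_class R [:: (x, true)] = (pres_class R [:: letter x])^-1 :> presented R.
Proof.
apply/(@divg1_eq (presented R)); rewrite invgK -pres_class_cons.
exact/pres_classP/(pres_cancel R [::] (x, true) [::]).
Qed.

Lemma subgroup_generators (A : set (presented R)) : subgroup A ->
  (forall x, A (pres_class R [:: letter x])) -> forall g, A g.
Proof.
move=> sA gA g; rewrite -(pres_reprK g); move: (pres_repr g).
elim=> [|[x b] w IHw]; first exact: (subgroup1 sA).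
rewrite -[_ :: w]/([:: (x, b)] ++ w) -pres_classM; apply: (subgroupM sA) => //.
by case: b; [rewrite pres_class_inv; apply: (subgroupV sA)|]; apply: gA.
Qed.

End Presentations.

Section Evaluation.
Variables (X : Type) (G : groupType) (f : X -> G).

Definition eval_letter (l : X * bool) : G := if l.2 then (f l.1)^-1 else f l.1.

Definition eval_word (w : word X) : G := \prod_(l <- w) eval_letter l.

Lemma eval_flip l : eval_letter (flip l) = (eval_letter l)^-1.
Proof. by case: l => x [] //=; rewrite /eval_letter /= invgK. Qed.

(** For trivial [K] this is the universal property of the presentation. A general normal [K] allows
    evaluation modulo [K] before any quotient group is available. *)
Lemma pres_eq_eval (R : word X -> word X -> Prop) (K : set G) :
  subgroup K -> normal_set K ->
  (forall r s, R r s -> K (eval_word r / eval_word s)) ->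
  forall u v, pres_eq R u v -> K (eval_word u / eval_word v).
Proof.
move=> sK nK RK u v.
elim=> {u v} [u|u v _ IH|v u w _ IHuv _ IHvw|u l v|u r s v /RK rs].
- by rewrite divgg; apply: subgroup1.
- by rewrite -[X in K X]invgK invgF; apply: subgroupV.
- by rewrite -(mulgVK (eval_word v) (eval_word u)) -mulgA; apply: subgroupM.
- rewrite /eval_word !big_cat !big_cons /= eval_flip mulKVg divgg.
  exact: subgroup1.
- rewrite /eval_word !big_cat /= !invgM -!mulgA.
  rewrite (mulgA _ _^-1) mulgV mul1g.
  (* Once [v] cancels, what remains is the quotient of [r] by [s] conjugated by the inverse of
     [u]. *)
  have := nK _ (eval_word u)^-1 rs; rewrite conjgE invgK.
  by rewrite /eval_word !mulgA.
Qed.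

End Evaluation.

(* The quotient of [G] by [K] is presented by the elements of [G], with all
   relations that hold modulo [K]. *)
Lemma quotient_exists (G : groupType) (K : set G) :
  subgroup K -> normal_set K ->
  exists (Q : groupType) (phi : UMagmaMorphism.type G Q),
    forall g, phi g = 1 <-> K g.
Proof.
move=> sK nK.
pose R (r s : word G) := K (eval_word id r / eval_word id s).
pose phi g : presented R := pres_class R [:: letter g].
have phiM : {morph phi : x y / x * y}.
  move=> x y; rewrite /phi -pres_class_cons; apply: pres_class_rel.
  rewrite /R /eval_word !big_cons !big_nil !mulg1 divgg; exact: subgroup1.
pose phi_mul := isMultiplicative.Build _ _ phi phiM.
pose phi0 : {multiplicative G -> presented R} := HB.pack phi phi_mul.
pose phi_one :=
  Multiplicative_isUMagmaMorphism.Build _ _ phi (multiplicative1 phi0).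
pose phi' : UMagmaMorphism.type G (presented R) := HB.pack phi phi_mul phi_one.
exists (presented R), phi' => g.
have evg : eval_word id [:: letter g] / eval_word id [::] = g.
  by rewrite /eval_word big_cons !big_nil invg1 !mulg1.
split=> [/pres_classP|Kg].
  (* The defining relations hold modulo [K], so nothing outside [K] is killed. *)
  by move/(pres_eq_eval sK nK (fun _ _ rs => rs)); rewrite evg.
by apply: pres_class_rel; rewrite /R evg.
Qed.

(** * Consequences of the braid relation *)

Lemma braid_commute_eq (G : groupType) (a b : G) :
  a * (b * a) = b * (a * b) -> commute a b -> a = b.
Proof. by move=> braid cab; move: braid; rewrite -cab => /mulIg. Qed.

(** The braid relation says that conjugating [a] by [a * b] yields [b]; hence [a] and [b] agree
    modulo commutators. *)
Lemma braid_div (G : groupType) (a b : G) :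
  a * (b * a) = b * (a * b) -> a / b = [~ a^-1, (a * b)^-1].
Proof.
move=> braid; rewrite commgEl conjgE !invgK -!mulgA; congr (_ * _).
apply: (mulIg (a * b)); rewrite -!mulgA mulVg mulg1.
by apply: (mulgI b); apply: (mulIg a); rewrite -!mulgA mulKVg mulVg mulg1.
Qed.

Lemma braid_collapse (G : groupType) (m : nat) (x : 'I_m -> G) :
  (forall i j, far i j -> commute (x i) (x j)) ->
  (forall i j : 'I_m, j = i.+1 :> nat ->
    x i * (x j * x i) = x j * (x i * x j)) ->
  (forall i j : 'I_m, i = 0 :> nat -> j = 1%N :> nat -> x i = x j) ->
  forall i j, x i = x j.
Proof.
move=> xfar xbraid x01.
have step k : forall i j : 'I_m, i = k :> nat -> j = k.+1 :> nat -> x i = x j.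
  elim: k => [|k IHk] // i j ik jk; apply: braid_commute_eq.
    by apply: xbraid; rewrite jk ik.
  (* Index [k] is at distance 2 from [j], and the induction hypothesis replaces [x i] by [x k]. *)
  have km : k < m by apply: leq_trans (ltn_ord i); rewrite ik ltnS.
  rewrite -(IHk (Ordinal km) i) //; apply: xfar.
  by rewrite /far /= jk ltnSn.
have to0 (m0 : 0 < m) (i : 'I_m) : x i = x (Ordinal m0).
  case: i; elim=> [|k IHk] km; first by congr x; apply: val_inj.
  by rewrite -(IHk (ltnW km)); apply/esym/(step k).
move=> i j; have m0 := leq_ltn_trans (leq0n i) (ltn_ord i).
by rewrite !(to0 m0).
Qed.

Section MetabelianQuotient.
Variables (G Q : groupType) (phi : UMagmaMorphism.type G Q).
Let D : set G := commutator setT setT.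
Hypothesis phiD : forall a b, D a -> D b -> commute (phi a) (phi b).

Lemma braid_image_collapse (m : nat) (x : 'I_m.+4 -> G) :
  (forall i j, far i j -> commute (x i) (x j)) ->
  (forall i j : 'I_m.+4, j = i.+1 :> nat ->
    x i * (x j * x i) = x j * (x i * x j)) ->
  forall i j, phi (x i) = phi (x j).
Proof.
move=> xfar xbraid.
have pfar i j : far i j -> commute (phi (x i)) (phi (x j)).
  by move=> /xfar xij; apply: gmulf_commute.
have pbraid (i j : 'I_m.+4) : j = i.+1 :> nat ->
    phi (x i) * (phi (x j) * phi (x i)) = phi (x j) * (phi (x i) * phi (x j)).
  by move=> ij; rewrite -!gmulfM xbraid.
apply: braid_collapse => // i j i0 j1; apply: braid_commute_eq.
  by apply: pbraid; rewrite i0 j1.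
have sD : subgroup D by apply: commutator_subgroup.
have Dxx (k l : 'I_m.+4) : l = k.+1 :> nat -> D (x k / x l).
  by move=> kl; rewrite (braid_div (xbraid _ _ kl)); apply: mem_commutator.
pose k2 : 'I_m.+4 := @Ordinal m.+4 2 isT.
pose k3 : 'I_m.+4 := @Ordinal m.+4 3 isT.
(* Quotients of non-adjacent generators telescope into quotients of adjacent ones. *)
have Dj3 : D (x j / x k3).
  rewrite -[x j](mulgVK (x k2)) -mulgA.
  by apply: (subgroupM sD); apply: Dxx; rewrite ?j1.
have Di3 : D (x i / x k3).
  rewrite -[x i](mulgVK (x j)) -mulgA.
  by apply: (subgroupM sD) => //; apply: Dxx; rewrite i0 j1.
have := phiD Di3 Dj3; rewrite !gmulfF.
have ci : commute (phi (x i)) (phi (x k3)) by apply: pfar; rewrite /far i0.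
have cj : commute (phi (x j)) (phi (x k3)) by apply: pfar; rewrite /far j1.
(* Both factors [phi (x k3)] move to the right and cancel, leaving the commutation of [phi (x i)]
   and [phi (x j)]. *)
move: ci cj => /commuteV/commute_sym ci /commuteV/commute_sym cj.
rewrite /commute -!mulgA (mulgA _^-1 (phi (x j))) cj.
rewrite (mulgA _^-1 (phi (x i))) ci !mulgA.
by move=> /mulIg/mulIg.
Qed.

End MetabelianQuotient.

(** Stated for arbitrary involutions so that it applies directly to images in a nilpotent group. *)
Lemma lower_central_braid (G : groupType) (a b : G) :
  a * a = 1 -> b * b = 1 -> a * (b * a) = b * (a * b) ->
  forall i, lower_central G i (a * b).
Proof.
move=> aa bb braid; elim=> [|i IHi] //=.
have aV : a^-1 = a by apply: (mulIg a); rewrite mulVg aa.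
have bV : b^-1 = b by apply: (mulIg b); rewrite mulVg bb.
(* Conjugation by [a] inverts [a * b], so the commutator is the inverse square of [a * b], an
   element of order dividing 3. *)
suff -> : a * b = [~ a * b, a] by apply: mem_commutator.
rewrite commgEl conjgE invgM aV bV -!mulgA (mulgA a a) aa mul1g.
by rewrite braid (mulgA b b) bb mul1g.
Qed.

(** * The morphism to the symmetric group *)

Lemma tperm_disjoint (T : finType) (x y z t : T) :
  x != z -> x != t -> y != z -> y != t ->
  tperm x y * tperm z t = tperm z t * tperm x y.
Proof. by move=> xz xt yz yt; rewrite conjgC tpermJ !tpermD // eq_sym. Qed.

(** Both sides are conjugates of transpositions, equal to [tperm x z]. *)
Lemma tperm_braid (T : finType) (x y z : T) : x != z -> y != x -> z != y ->
  tperm x y * (tperm y z * tperm x y) = tperm y z * (tperm x y * tperm y z).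
Proof.
move=> xz yx zy.
have E (s t u v : T) : tperm s t * (tperm u v * tperm s t) =
                       tperm u v ^ tperm s t by rewrite conjgE tpermV.
by rewrite !E !tpermJ tpermL tpermR !tpermD // eq_sym.
Qed.

Section Permutations.
Variable n : nat.

(** Both [i] and [i.+1] are at most [n.+1], so [inord] never takes its default value. *)
Definition vsg_perm (x : vsg_gen n.+2) : 'S_n.+2 :=
  if x is Virt i then tperm (inord i) (inord i.+1) else 1.

Lemma inord_neq (i j : nat) : i <= n.+1 -> j <= n.+1 -> (i < j) || (j < i) ->
  inord i != inord j :> 'I_n.+2.
Proof.
move=> im jm; rewrite -neq_ltn; apply: contraNneq => /(congr1 (@nat_of_ord _)).
by rewrite !inordK // => ->.
Qed.

Lemma vsg_perm_rel r s : vsg_rel r s ->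
  eval_word vsg_perm r = eval_word vsg_perm s.
Proof.
case=> {r s} [i j _|i j|i j _|i j _|i j _|i j _|i|i|i j _|i j ij|i j _|i j _|
  i j _|i j _]; rewrite /eval_word !big_cons !big_nil /eval_letter /=
  ?mulg1 ?mul1g ?tperm2 //.
- have := ltn_ord i; have := ltn_ord j => /= jn im ij.
  by apply: tperm_disjoint; apply: inord_neq => //; case/orP: ij; lia.
- move: i j ij => /= i j ij.
  have := ltn_ord i; have := ltn_ord j => jn im; rewrite ij in jn *.
  by apply: tperm_braid; apply: inord_neq => //; lia.
Qed.

End Permutations.

Lemma vsg_v0v1_neq1 n (i j : 'I_n.-1) : i = 0 :> nat -> j = 1%N :> nat ->
  pres_class (@vsg_rel n) [:: letter (Virt i); letter (Virt j)] <> 1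
    :> VSG n.
Proof.
case: n i j => [|[|n]] i j; [by case: i|by case: i|move=> i0 j1].
have relK r s : vsg_rel r s ->
    [set 1] (eval_word (@vsg_perm n) r / eval_word (@vsg_perm n) s).
  by move=> /vsg_perm_rel ->; rewrite divgg.
move/pres_classP/(pres_eq_eval (@subgroup_set1 _) (@normal_set1 _) relK) => /=.
rewrite /eval_word !big_cons !big_nil /eval_letter /= invg1 !mulg1 i0 j1.
have n0 : 0 < n by have := ltn_ord j; rewrite j1.
(* The product of the two transpositions sends 0 to 2; [n0] ensures that 2 is a genuine point. *)
move=> /(congr1 (fun s : 'S_n.+2 => val (s (inord 0)))).
by rewrite permM tpermL tpermL perm1 /= !inordK.
Qed.

(** * The defining relations as identities in the group *)

Section Relations.
Variable n : nat.
Local Notation R := (@vsg_rel n).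
Definition sg (i : 'I_n.-1) : VSG n := pres_class R [:: letter (Sigma i)].
Definition tg (i : 'I_n.-1) : VSG n := pres_class R [:: letter (Tau i)].
Definition vg (i : 'I_n.-1) : VSG n := pres_class R [:: letter (Virt i)].

Ltac vsg := by move=> *; rewrite /commute /sg /tg /vg -!pres_class_cons;
  apply: pres_class_rel; constructor.

Lemma sg_far i j : far i j -> commute (sg i) (sg j). Proof. vsg. Qed.
Lemma vg_far i j : far i j -> commute (vg i) (vg j). Proof. vsg. Qed.
Lemma sg_vg_far i j : far i j -> commute (sg i) (vg j). Proof. vsg. Qed.
Lemma tg_vg_far i j : far i j -> commute (tg i) (vg j). Proof. vsg. Qed.
Lemma sg_tg i : commute (sg i) (tg i). Proof. vsg. Qed.
Lemma vg2 i : vg i * vg i = 1. Proof. vsg. Qed.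

Lemma sg_braid (i j : 'I_n.-1) : j = i.+1 :> nat ->
  sg i * (sg j * sg i) = sg j * (sg i * sg j).
Proof. vsg. Qed.

Lemma vg_braid (i j : 'I_n.-1) : j = i.+1 :> nat ->
  vg i * (vg j * vg i) = vg j * (vg i * vg j).
Proof. vsg. Qed.

Lemma sg_sg_tg (i j : 'I_n.-1) : j = i.+1 :> nat ->
  sg i * (sg j * tg i) = tg j * (sg i * sg j).
Proof. vsg. Qed.

End Relations.

(** * Residual nilpotence and the derived subgroup *)

Lemma vsg_not_residually_nilpotent n : 3 <= n ->
  ~ residually_nilpotent (VSG n).
Proof.
case: n => [|[|[|n]]] // _ rn.
pose a := vg (@Ordinal n.+2 0 isT : 'I_n.+3.-1).
pose b := vg (@Ordinal n.+2 1 isT : 'I_n.+3.-1).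
have ab1 : a * b <> 1.
  by rewrite /a /b /vg -pres_class_cons; apply: vsg_v0v1_neq1.
have [N [phi [[c Nc] _ phiab]]] := rn _ ab1; apply: phiab.
(* Term [c] is trivial, yet it contains the image of [a * b], as every term does. *)
have: lower_central N c (phi (a * b)); last by rewrite Nc.
rewrite gmulfM; apply: lower_central_braid; rewrite -!gmulfM.
- by rewrite vg2 multiplicative1.
- by rewrite vg2 multiplicative1.
- by rewrite vg_braid.
Qed.

(** Each of the three families of generators has a single image, and these three images commute
    pairwise. *)
Lemma vsg_metabelian_image_abelian n (Q : groupType)
    (phi : UMagmaMorphism.type (VSG n.+1.+4) Q) :
  (forall a b, commutator setT setT a -> commutator setT setT b ->
     commute (phi a) (phi b)) ->
  forall x y, commute (phi x) (phi y).
Proof.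
move=> phiD.
pose i0 := ord0 : 'I_n.+1.+4.-1.
pose i2 := @Ordinal n.+4 2 isT : 'I_n.+1.+4.-1.
have sE i j : phi (sg i) = phi (sg j).
  exact: (braid_image_collapse phiD (@sg_far n.+1.+4) (@sg_braid n.+1.+4)).
have vE i j : phi (vg i) = phi (vg j).
  exact: (braid_image_collapse phiD (@vg_far n.+1.+4) (@vg_braid n.+1.+4)).
have st i j : commute (phi (sg i)) (phi (tg j)).
  by rewrite (sE i j); apply/gmulf_commute/sg_tg.
have tS (i j : 'I_n.+1.+4.-1) : j = i.+1 :> nat -> phi (tg i) = phi (tg j).
  move=> /sg_sg_tg/(congr1 phi); rewrite !gmulfM (sE j i).
  (* Moving [phi (tg j)] past the two equal sigma images allows them to be cancelled. *)
  have ts := commute_sym (st i j).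
  by rewrite (commuteM ts ts) mulgA => /mulgI.
have t0 j : phi (tg j) = phi (tg i0).
  case: j; elim=> [|k IHk] kn; first by congr (phi (tg _)); apply: val_inj.
  by rewrite -(IHk (ltnW kn)); apply/esym/tS.
have sv i j : commute (phi (sg i)) (phi (vg j)).
  (* Any pair of indices may be replaced by the far pair 0 and 2. *)
  by rewrite (sE i i0) (vE j i2); apply/gmulf_commute/sg_vg_far.
have tv i j : commute (phi (tg i)) (phi (vg j)).
  by rewrite (t0 i) (vE j i2); apply/gmulf_commute/tg_vg_far.
have centralizer_subgroup y : subgroup [set x | commute y (phi x)].
  apply/subgroupP; split=> [|u w /= yu yw]; rewrite /= ?gmulf1 ?gmulfF.
    exact: commute1.
  by apply: commuteM => //; apply: commuteV.
(* Centralizers reduce the claim to generators, first in one argument and then in the other. *)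
move=> x; apply: (subgroup_generators (centralizer_subgroup (phi x))) => g.
apply: commute_sym; move: x.
apply: (subgroup_generators (centralizer_subgroup (phi _))) => h /=.
have ss i j : commute (phi (sg i)) (phi (sg j)) by rewrite (sE i j).
have tt i j : commute (phi (tg i)) (phi (tg j)) by rewrite (t0 i) (t0 j).
have vv i j : commute (phi (vg i)) (phi (vg j)) by rewrite (vE i j).
case: g h => i [] j; first
  [exact: ss|exact: st|exact: sv|exact: tt|exact: tv|exact: vv
  |exact/commute_sym/st|exact/commute_sym/sv|exact/commute_sym/tv].
Qed.

Lemma vsg_derived_perfect n : 5 <= n ->
  perfect_subgroup (commutator [set: VSG n] [set: VSG n]).
Proof.
case: n => [|[|[|[|[|n]]]]] // _; set D := commutator _ _.
have sD : subgroup (commutator D D) := commutator_subgroup D D.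
have nT : normal_set [set: VSG n.+1.+4] by [].
have nD : normal_set (commutator D D).
  by apply: commutator_normal; apply: commutator_normal.
apply/seteqP; split; last first.
  apply: commutator_sub => [|a b _ _]; first exact: commutator_subgroup.
  exact: mem_commutator.
(* The kernel of [phi] is exactly the derived subgroup of [D]; once the image of [phi] is abelian,
   every commutator lies in this kernel. *)
have [Q [phi phiK]] := quotient_exists sD nD.
have phiC : forall x y, commute (phi x) (phi y).
  apply: vsg_metabelian_image_abelian => a b Da Db.
  apply/commgP/eqP; rewrite -gmulfR; apply/phiK.
  exact: (mem_commutator Da Db).
apply: commutator_sub => // a b _ _; apply/phiK; rewrite gmulfR.
exact/eqP/commgP.
Qed.

Theorem theorem8 (n : nat) (hn : 2 <= n) :
  (3 <= n -> ~ residually_nilpotent (VSG n)) /\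
  (5 <= n ->
    perfect_subgroup (commutator [set: VSG n]%classic [set: VSG n]%classic)).
Proof.
by split; [apply: vsg_not_residually_nilpotent|apply: vsg_derived_perfect].
Qed.
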